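(* Let $d>0$ and $c>0$ be the absolute constants specified in the context. There exist a constant $\gamma>0$ and an integer $K_1$ such that the following holds. For all integers $K\ge K_1$ and $T\ge 1$ with $\sqrt{c\ln K/T}<d$, and for every (deterministic or randomized) algorithm for the stochastic full-information bandit problem with $K$ arms, there exists a problem instance on which the expected (pseudo-)regret $\mathbb{E}[R(T)]$ of the algorithm over $T$ rounds satisfies $$\mathbb{E}[R(T)]\ \ge\ \gamma\sqrt{T\log K}.$$
   Context: Stochastic full-information bandit: there are $K$ arms and a distribution on $[0,1]^K$ (the problem instance). In each round $t$ a reward vector $X^{(t)}\in[0,1]^K$ is drawn from it, independently across rounds; the algorithm chooses an arm $I_t$ based on the reward vectors of previous rounds (and possibly its own independent randomness), gains $X^{(t)}_{I_t}$, and then observes the whole vector $X^{(t)}$. With $\mu_i=\mathbb{E}[X_i^{(t)}]$ and $\mu^*=\max_i\mu_i$, $\mathbb{E}[R(T)]=\mathbb{E}[\sum_{t=1}^T(\mu^*-\mu_{I_t})]$. Constants. Let $c',d,p>0$ be absolute constants such that for i.i.d. Bernoulli$(1/2)$ variables $X_1,\dots,X_n$ and all $0<\varepsilon<d$ with $\varepsilon^2 n>p$ one has $\Pr\{\frac1n\sum_{i=1}^n X_i>\frac12+\varepsilon\}>e^{-c'n\varepsilon^2}$ (such constants exist). For $j\in[K]$ and $\varepsilon>0$, let $\mathcal I_j$ be the instance in which the arms are independent Bernoulli variables with $\mu_j=\frac{1+\varepsilon}{2}$ and $\mu_k=\frac12$ for $k\ne j$. In the bandit-with-prediction problem, an algorithm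 is given the rewards of all $K$ arms in the first $T$ rounds and outputs an arm $y_T\in[K]$. The constant $c>0$ is an absolute constant small enough that the following holds: there is $K_0$ such that for all $K\ge K_0$, all $0<\varepsilon<d$ and all integers $T$ with $\frac{c\ln K}{2\varepsilon^2}\le T\le\frac{c\ln K}{\varepsilon^2}$, for any (deterministic or randomized) algorithm for the bandit-with-prediction problem there are at least $\lceil K/3\rceil$ arms $j$ with $\Pr\{y_T=j\mid\mathcal I_j\}\le\frac34$ (such constants exist). *)

(* Defs.v *)
From HB Require Import structures.
From mathcomp Require Import all_boot all_order all_algebra.
From mathcomp Require Import all_classical all_reals all_analysis.

Set Implicit Arguments.
Unset Strict Implicit.
Unset Printing Implicit Defensive.

Import Order.TTheory GRing.Theory Num.Theory.
Import numFieldNormedType.Exports.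

Local Open Scope classical_set_scope.
Local Open Scope ring_scope.

Section product_law.
Context d (T : measurableType d) (R : realType).

Definition cons_pair n (z : T * n.-tuple T) : n.+1.-tuple T :=
  [tuple of z.1 :: z.2].

Lemma measurable_cons_pair n : measurable_fun setT (@cons_pair n).
Proof. exact: measurable_cons. Qed.

HB.instance Definition _ n :=
  isMeasurableFun.Build _ _ _ _ (@cons_pair n) (@measurable_cons_pair n).

(* The joint law of n independent T-valued variables with laws P 0, .., P n.-1,
   obtained by iterating the binary product measure; see product_law_box. *)
Fixpoint product_law n : ('I_n -> probability T R) -> probability (n.-tuple T) R :=
  match n with
  | 0 => fun=> \d_([tuple] : 0.-tuple T)
  | m.+1 => fun P =>
      distribution (P ord0 \x product_law (P \o lift ord0))%E (@cons_pair m)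
  end.

Lemma product_law_box n (P : 'I_n -> probability T R) (A : 'I_n -> set T) :
  (forall i, measurable (A i)) ->
  product_law P [set x | forall i, A i (tnth x i)] =
  (\prod_(i < n) P i (A i))%E.
Proof.
elim: n P A => [|n IHn] P A mA.
  by rewrite big_ord0 /= diracE mem_set// => -[].
rewrite big_ord_recl /= /distribution /pushforward.
set B := [set x : n.-tuple T | forall i, A (lift ord0 i) (tnth x i)].
have -> : @cons_pair n @^-1` [set x | forall i, A i (tnth x i)] = A ord0 `*` B.
  apply/seteqP; split => -[a x] /=.
    move=> h; split=> /=; first by have := h ord0; rewrite tnth0.
    by move=> i; have := h (lift ord0 i); rewrite tnthS.
  move=> [/= ha hx] i; case: (unliftP ord0 i) => [j ->|->].
    by rewrite tnthS; exact: hx.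
  by rewrite tnth0.
have mB : measurable B.
  have -> : B =
      \bigcap_(i in [set: 'I_n]) ((@tnth n T)^~ i @^-1` A (lift ord0 i)).
    by apply/seteqP; split=> x /= h i; [move=> _; exact: h|exact: h].
  apply: fin_bigcap_measurable => [|i _]; first exact: finite_finset.
  by rewrite -[X in measurable X]setTI; exact: measurable_tnth.
rewrite product_measure1E//; congr (_ * _)%E.
exact: (IHn (P \o lift ord0) (A \o lift ord0) (fun i => mA _)).
Qed.

Definition iid_law n (P : probability T R) : probability (n.-tuple T) R :=
  product_law (fun=> P).

End product_law.

Section bernoulli_real.
Context (R : realType).

Definition bool_real (b : bool) : R := b%:R.

Lemma measurable_bool_real : measurable_fun setT bool_real.
Proof. by []. Qed.

HB.instance Definition _ :=
  isMeasurableFun.Build _ _ _ _ bool_real measurable_bool_real.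

(* As for bernoulli_prob, meaningful only when 0 <= q <= 1. *)
Definition bernoulli_real (q : R) : probability R R :=
  distribution (bernoulli_prob q) bool_real.

End bernoulli_real.

Section bandit.
Context (R : realType) (K : nat).

(* A problem instance: the common law of the reward vectors X^(1), X^(2), ... *)
Record bandit_instance := BanditInstance {
  reward_law :> probability (K.-tuple R) R ;
  reward_law01 : reward_law [set x | forall i, 0 <= tnth x i <= 1] = 1%E }.

Definition arm_mean (D : bandit_instance) (i : 'I_K) : R :=
  fine 'E_(reward_law D)[fun x => tnth x i].

(* Rewards are nonnegative, so the default value 0 never exceeds the maximum. *)
Definition best_mean (D : bandit_instance) : R :=
  \big[Num.max/0]_(i < K) arm_mean D i.

(* [play n s x] is the arm played in round n.+1 when the internal randomness
   (drawn once, independently of the rewards) is s and x lists the reward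
   vectors of rounds 1, .., n. A deterministic algorithm ignores s. *)
Record bandit_algorithm := BanditAlgorithm {
  seed_disp : measure_display ;
  seed : measurableType seed_disp ;
  seed_law : probability seed R ;
  play : forall n, seed -> n.-tuple (K.-tuple R) -> 'I_K ;
  measurable_play : forall n (i : 'I_K),
    measurable [set z : seed * n.-tuple (K.-tuple R) | play z.1 z.2 = i] }.

Definition history T (x : T.-tuple (K.-tuple R)) (t : 'I_T) :
    t.-tuple (K.-tuple R) :=
  [tuple tnth x (widen_ord (ltnW (ltn_ord t)) i) | i < t].

Definition expected_regret (A : bandit_algorithm) (D : bandit_instance)
    (T : nat) : \bar R :=
  'E_(seed_law A \x iid_law T (reward_law D))%E
    [fun z => \sum_(t < T)
       (best_mean D - arm_mean D (play z.1 (history z.2 t)))].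

Record predictor (T : nat) := Predictor {
  pseed_disp : measure_display ;
  pseed : measurableType pseed_disp ;
  pseed_law : probability pseed R ;
  predict : pseed -> T.-tuple (K.-tuple R) -> 'I_K ;
  measurable_predict : forall i : 'I_K,
    measurable [set z : pseed * T.-tuple (K.-tuple R) | predict z.1 z.2 = i] }.

Definition predict_prob T (A : predictor T) (D : probability (K.-tuple R) R)
    (j : 'I_K) : \bar R :=
  (pseed_law A \x iid_law T D)%E [set z | predict z.1 z.2 = j].

Definition biased_arm_law (j : 'I_K) (eps : R) : probability (K.-tuple R) R :=
  product_law
    (fun k => bernoulli_real (if k == j then (1 + eps) / 2 else 1 / 2)).

End bandit.

Definition bernoulli_tail_constants (R : realType) (c' d p : R) : Prop :=
  [/\ 0 < c', 0 < d, 0 < p &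
    forall (n : nat) (eps : R), 0 < eps < d -> p < eps ^+ 2 * n%:R ->
    ((expR (- c' * n%:R * eps ^+ 2))%:E <
     iid_law n (bernoulli_real (1 / 2))
       [set x | (1 / 2 + eps < n%:R^-1 * \sum_(i < n) tnth x i)%R])%E].

Definition prediction_constant (R : realType) (d c : R) : Prop :=
  0 < c /\
  exists K0 : nat, forall K : nat, (K0 <= K)%N ->
  forall eps : R, 0 < eps < d ->
  forall T : nat,
    c * ln K%:R / (2 * eps ^+ 2) <= T%:R <= c * ln K%:R / eps ^+ 2 ->
  forall A : predictor R K T,
    Num.ceil (K%:R / 3 : R) <=
    #|[pred j : 'I_K | (predict_prob A (biased_arm_law j eps) j
                         <= (3 / 4)%:E)%E]|%:Z.

(* Main.v *)
(* With eps = sqrt (c ln K / T), the arm played in each round is a prediction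
   based on (part of) T reward vectors, so in each round at least K/3 arms j are
   played with probability at most 3/4 on the instance biased towards j. By
   averaging over j, some fixed j is bad in this sense in at least T/3 rounds;
   each of these rounds costs at least eps/8 on that instance, which gives
   regret at least eps T / 24 = (sqrt c / 24) sqrt (T ln K).
   The tail bound serves only to force d <= 1/2, so that (1 + eps)/2 is a
   genuine Bernoulli parameter: for d > 1/2 it would give positive probability to an
   average of Bernoulli variables exceeding 1. *)

Require Import Defs.
From mathcomp Require Import all_boot all_order all_algebra.
From mathcomp Require Import all_classical all_reals all_analysis.
From mathcomp Require Import measurable_realfun lra.

Set Implicit Arguments.
Unset Strict Implicit.

Import Order.TTheory GRing.Theory Num.Theory.
Local Open Scope ring_scope.
Local Open Scope classical_set_scope.

(** * Marginals and means of products of Bernoulli laws *)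

Lemma product_law_marginal {disp : measure_display}
    {S : measurableType disp} (R : realType) (n : nat)
    (P : 'I_n -> probability S R) (i : 'I_n) (A : set S) :
  measurable A -> product_law P [set x : n.-tuple S | A (tnth x i)] = P i A.
Proof.
(* The cylinder is a box whose other sides are the whole space, each of mass 1. *)
move=> mA; pose B k : set S := if k == i then A else setT.
have -> : [set x : n.-tuple S | A (tnth x i)] =
          [set x : n.-tuple S | forall k, B k (tnth x k)].
  apply/seteqP; split=> x /=.
    by move=> Ax k; rewrite /B; case: eqVneq => [->|].
  by move=> /(_ i); rewrite /B eqxx.
rewrite product_law_box; last by move=> k; rewrite /B; case: eqP.
rewrite (bigD1 i)//= big1 ?mule1 /B ?eqxx// => k /negPf ->.
exact: probability_setT.
Qed.

Lemma bernoulli_real_itv01 (R : realType) (q : R) :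
  bernoulli_real q [set x | 0 <= x <= 1] = 1%E.
Proof.
rewrite -[RHS](probability_setT (bernoulli_prob q)).
rewrite /bernoulli_real /distribution /pushforward; congr (bernoulli_prob q _).
by apply/seteqP; split=> // -[] _ /=; rewrite /bool_real /= ?lexx ?ler01.
Qed.

Lemma measurable_itv01 (R : realType) : measurable [set x : R | 0 <= x <= 1].
Proof. by rewrite -set_itvcc; exact: measurable_itv. Qed.

Lemma bernoulli_product_01 (R : realType) (n : nat) (q : 'I_n -> R) :
  product_law (fun k => bernoulli_real (q k))
    [set x | forall i, 0 <= tnth x i <= 1] = 1%E.
Proof.
rewrite (@product_law_box _ _ _ _ _ (fun=> [set x : R | 0 <= x <= 1])).
  by rewrite big1// => i _; exact: bernoulli_real_itv01.
by move=> _; exact: measurable_itv01.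
Qed.

(** The law is convertible to [biased_arm_law j eps], so that regret on this instance can be
    expressed by [predict_prob] under that law. *)
Definition biased_instance {R : realType} {K : nat} (j : 'I_K) (eps : R) :
    bandit_instance R K :=
  BanditInstance (bernoulli_product_01 (fun k : 'I_K =>
    if k == j then (1 + eps) / 2 else 1 / 2)).

Lemma expectation_bernoulli_product (R : realType) (n : nat) (q : 'I_n -> R)
    (i : 'I_n) : 0 <= q i <= 1 ->
  ('E_(product_law (fun k => bernoulli_real (q k)))[fun x => tnth x i]
   = (q i)%:E)%E.
Proof.
move=> q01; set P := product_law _.
rewrite unlock.
(* The integrand is cut off at 0 so that change of variables for nonnegative
   functions applies. *)
transitivity (\int[P]_x (Num.max 0 (tnth x i))%:E)%E.
  apply: ae_eq_integral => //.
  - by apply/measurable_EFinP; exact: measurable_tnth.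
  - apply/measurable_EFinP; apply: measurable_maxr => //.
    exact: measurable_tnth.
  (* The cutoff alters [tnth x i] only outside [0, 1], an event of probability 0 under a Bernoulli
     marginal. *)
  exists (~` [set x | 0 <= tnth x i <= 1]).
  have m01 : measurable [set x : n.-tuple R | 0 <= tnth x i <= 1].
    rewrite -[X in measurable X]setTI.
    exact: (measurable_tnth i measurableT (@measurable_itv01 R)).
  split; first exact: measurableC.
  - apply: etrans (probability_setC P m01) _.
    rewrite (product_law_marginal _ i (@measurable_itv01 R)).
    by rewrite bernoulli_real_itv01 subee.
  move=> x /= + /andP[x0 _]; apply => _.
  by rewrite max_r.
have mmax : measurable_fun setT (fun y : R => (Num.max 0 y)%:E).
  by apply/measurable_EFinP; exact: measurable_maxr.
have max0 (y : R) : (0 <= (Num.max 0 y)%:E)%E by rewrite lee_fin le_max lexx.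
transitivity (\int[pushforward P (fun x => tnth x i)]_y (Num.max 0 y)%:E)%E.
  by rewrite ge0_integral_pushforward//; exact: measurable_tnth.
rewrite (eq_measure_integral (bernoulli_real (q i))); last first.
  move=> mtnth A mA _; exact: (product_law_marginal _ i mA).
  exact: measurable_tnth.
rewrite ge0_integral_distribution// integral_bernoulli_prob//=.
by rewrite /bool_real/= maxxx mule0 adde0 max_r// mule1.
Qed.

Section biased_instance_means.
Context (R : realType) (K : nat) (j : 'I_K) (eps : R).
Hypothesis eps01 : 0 <= eps <= 1.

Lemma arm_mean_biased (i : 'I_K) :
  arm_mean (biased_instance j eps) i =
  if i == j then (1 + eps) / 2 else 1 / 2.
Proof.
rewrite /arm_mean /= expectation_bernoulli_product//.
by move: eps01 => /andP[? ?]; case: ifP => _; lra.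
Qed.

Lemma best_mean_biased :
  best_mean (biased_instance j eps) = (1 + eps) / 2.
Proof.
apply/eqP; rewrite eq_le; apply/andP; split.
  rewrite /best_mean; apply: bigmax_le => [|i _].
    by move: eps01 => /andP[? ?]; lra.
  by rewrite arm_mean_biased; move: eps01 => /andP[? ?]; case: ifP => _; lra.
by apply: le_trans (le_bigmax _ _ j); rewrite arm_mean_biased eqxx.
Qed.

End biased_instance_means.

(** * The range of the constant [d] *)

Lemma tail_constants_le_half (R : realType) (c' d p : R) :
  bernoulli_tail_constants c' d p -> d <= 1 / 2.
Proof.
move=> [_ _ p0 tail]; rewrite leNgt; apply/negP => d2.
(* This size gives p < (1/2)^2 n, so the tail bound would apply at deviation 1/2, where the average
   must exceed 1. *)
pose n := (Num.truncn (4 * p)).+1.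
have n4p : 4 * p < n%:R by exact: truncnS_gt.
have half : 0 < (1 / 2 : R) < d by apply/andP; split=> //; lra.
have /(tail n _ half) : p < (1 / 2) ^+ 2 * n%:R by rewrite expr2; lra.
set E := [set x | _]; rewrite ltNge => /negP; apply.
have mE : measurable E.
  have mavg : measurable_fun setT
      (fun x : n.-tuple R => n%:R^-1 * \sum_(i < n) tnth x i).
    apply: measurable_funM => //; apply: measurable_sum => i.
    exact: measurable_tnth.
  rewrite -[E]setTI (_ : E = (fun x : n.-tuple R =>
      n%:R^-1 * \sum_(i < n) tnth x i) @^-1` `]1 / 2 + 1 / 2, +oo[).
    exact: (mavg measurableT _ (measurable_itv _)).
  by rewrite set_itvoy.
pose F := [set x : n.-tuple R | forall i, 0 <= tnth x i <= 1].
have F1 : iid_law n (bernoulli_real (1 / 2)) F = 1%E.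
  exact: (bernoulli_product_01 (fun=> 1 / 2)).
have mF : measurable F.
  have -> : F =
      (\bigcap_(i in [set: 'I_n])
         ((@tnth n R)^~ i @^-1` [set y | 0 <= y <= 1])).
    by apply/seteqP; split=> x /= h i; [move=> _; exact: h|exact: h].
  apply: fin_bigcap_measurable => [|i _]; first exact: finite_finset.
  rewrite -[X in measurable X]setTI.
  exact: (measurable_tnth i measurableT (@measurable_itv01 R)).
(* On [F] the average is at most 1, so [E] lies in the complement of [F], which is null. *)
apply: (@le_trans _ _ (iid_law n (bernoulli_real (1 / 2)) (~` F))).
  apply: le_measure; rewrite ?inE//; first exact: measurableC.
  move=> x; rewrite /E/= => + x01; apply/negP; rewrite -leNgt.
  rewrite mulrC ler_pdivrMr ?ltr0n//.
  have -> : (1 / 2 + 1 / 2 : R) * n%:R = \sum_(i < n) 1.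
    by rewrite sumr_const card_ord; lra.
  by apply: ler_sum => i _; have /andP[] := x01 i.
by rewrite probability_setC// F1 subee// lee_fin expR_ge0.
Qed.

(** * Single rounds as predictions, and the regret they cause *)

Lemma measurable_history (R : realType) (K T : nat) (t : 'I_T) :
  measurable_fun setT (fun x : T.-tuple (K.-tuple R) => history x t).
Proof.
apply/measurable_fun_tnthP => i.
rewrite (_ : _ \o _ =
    fun x => tnth x (widen_ord (ltnW (ltn_ord t)) i)); last first.
  by apply/funext => x /=; rewrite tnth_mktuple.
exact: measurable_tnth.
Qed.

Lemma measurable_play_history (R : realType) (K T : nat)
    (A : bandit_algorithm R K) (t : 'I_T) (i : 'I_K) :
  measurable [set z : seed A * T.-tuple (K.-tuple R) |
    play z.1 (history z.2 t) = i].
Proof.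
pose f (z : seed A * T.-tuple (K.-tuple R)) := (z.1, history z.2 t).
have mf : measurable_fun setT f.
  apply: measurable_fun_pair => //.
  apply: (measurableT_comp (@measurable_history R K T t) measurable_snd).
by have := mf measurableT _ (@measurable_play R K A t i); rewrite setTI.
Qed.

(* The predictor sees all T reward vectors but uses only the first t, so that
   its sample space is the one over which the regret is averaged. *)
Definition round_predictor {R : realType} {K T : nat}
    (A : bandit_algorithm R K) (t : 'I_T) : predictor R K T :=
  @Predictor _ _ _ _ _ (seed_law A) (fun s x => play s (history x t))
    (@measurable_play_history R K T A t).

(** A round costs 0 if arm [j] is played and exactly eps / 2 otherwise; linearity of expectation
    leaves the probability of missing [j] in each round. *)
Lemma expected_regret_biased (R : realType) (K T : nat)
    (A : bandit_algorithm R K) (j : 'I_K) (eps : R) : 0 <= eps <= 1 ->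
  expected_regret A (biased_instance j eps) T =
  (\sum_(t < T) (eps / 2)%:E *
    (1 - predict_prob (round_predictor A t) (biased_arm_law j eps) j))%E.
Proof.
move=> eps01; have eps2 : 0 <= eps / 2 by move: eps01 => /andP[? _]; lra.
pose N t := (~` [set z : seed A * T.-tuple (K.-tuple R) |
                 play z.1 (history z.2 t) = j]).
have mN t : measurable (N t).
  by apply: measurableC; exact: measurable_play_history.
rewrite /expected_regret unlock.
under eq_integral => z _.
  rewrite (eq_bigr (fun t => eps / 2 * \1_(N t) z)); last first.
    move=> t _; rewrite best_mean_biased// arm_mean_biased// indicE.
    case: eqP => [e|ne]; first by rewrite memNset ?mulr0 ?subrr//; exact.
    by rewrite mem_set// mulr1; lra.
  rewrite -sumEFin; over.
rewrite /= ge0_integral_sum//.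
- apply: eq_bigr => t _.
  under eq_integral do rewrite EFinM.
  rewrite ge0_integralZl_EFin//.
  + rewrite integral_indic// setIT.
    by congr (_ * _)%E; apply: probability_setC; exact: measurable_play_history.
  + exact/measurable_EFinP/measurable_indic.
- move=> t; apply/measurable_EFinP; exact: measurable_funM.
- by move=> t z _; rewrite lee_fin mulr_ge0.
Qed.

(** * Averaging over arms, and the lower bound *)

Lemma exists_frequent_column (I J : finType) (b : I -> J -> bool) :
  (0 < #|J|)%N -> (forall i, (#|J| <= 3 * \sum_j b i j)%N) ->
  exists j, (#|I| <= 3 * \sum_i b i j)%N.
Proof.
move=> J0 brow; apply/existsP; rewrite -[X in is_true X]negbK negb_exists.
apply/negP => /forallP bcol.
(* Count the true entries of [b] twice: by rows they fill at least a third of the matrix, by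
   columns, under [bcol], less than a third. *)
have : (#|I| * #|J| <= 3 * \sum_i \sum_j b i j)%N.
  by rewrite -sum_nat_const big_distrr; apply: leq_sum => i _; exact: brow.
apply/negP; rewrite -ltnNge exchange_big/= big_distrr/= mulnC -sum_nat_const.
(* Strictness needs an actual column: one is split off, the others are bounded weakly. *)
have /card_gt0P[j0 _] := J0.
rewrite (bigD1 j0)//= [X in (_ < X)%N](bigD1 j0)//=.
rewrite -addSn leq_add//; first by rewrite ltnNge bcol.
by apply: leq_sum => j _; rewrite ltnW// ltnNge bcol.
Qed.

Local Close Scope classical_set_scope.

Theorem theorem4 (R : realType) (c' d p c : R)
    (tail_cst : bernoulli_tail_constants c' d p)
    (pred_cst : prediction_constant d c) :
  exists gamma : R, 0 < gamma /\
  exists K1 : nat, forall K T : nat, (K1 <= K)%N -> (1 <= T)%N ->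
    Num.sqrt (c * ln K%:R / T%:R) < d ->
  forall A : bandit_algorithm R K,
  exists D : bandit_instance R K,
    ((gamma * Num.sqrt (T%:R * ln K%:R))%:E <= expected_regret A D T)%E.
Proof.
have d2 := tail_constants_le_half tail_cst.
have [c0 [K0 pred]] := pred_cst.
exists (Num.sqrt c / 24); split; first by rewrite divr_gt0 ?sqrtr_gt0.
(* K >= 2 makes ln K positive. *)
exists (maxn K0 2) => K T; rewrite geq_max => /andP[K0K K2] T1.
set eps := Num.sqrt _ => epsd A.
have lnK : 0 < ln K%:R :> R by rewrite ln_gt0 ?ltr1n.
have T0 : 0 < T%:R :> R by rewrite ltr0n.
have x0 : 0 < c * ln K%:R / T%:R by rewrite divr_gt0 ?mulr_gt0.
have eps0 : 0 < eps by rewrite sqrtr_gt0.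
have eps01 : 0 <= eps <= 1 by apply/andP; split; lra.
(* This choice of [eps] puts T at the upper end of the range in [prediction_constant]; the lower end
   is T / 2. *)
have epsT : c * ln K%:R / eps ^+ 2 = T%:R.
  by rewrite sqr_sqrtr ?(ltW x0)// invf_div mulrC divfK// gt_eqF ?mulr_gt0.
have Trange :
    c * ln K%:R / (2 * eps ^+ 2) <= T%:R <= c * ln K%:R / eps ^+ 2.
  by rewrite invfM mulrCA epsT lexx andbT; lra.
pose bad (t : 'I_T) (j : 'I_K) :=
  (predict_prob (round_predictor A t) (biased_arm_law j eps) j
    <= (3 / 4)%:E)%E.
have [] := @exists_frequent_column _ _ bad.
- by rewrite card_ord ltnW.
- move=> t; rewrite card_ord -big_mkcond/= sum1_card.
  have := pred K K0K eps; rewrite eps0 epsd => /(_ isT T Trange).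
  move=> /(_ (round_predictor A t)); rewrite ceil_le_int.
  rewrite ler_pdivrMr// mulrC => h.
  by rewrite -(ler_nat R) natrM.
rewrite card_ord => j badj.
exists (biased_instance j eps); rewrite expected_regret_biased//.
(* A bad round misses [j] with probability at least 1/4, so it costs at least (eps / 2) / 4 = eps /
   8; any other round costs at least 0. *)
apply: (@le_trans _ _ (\sum_(t < T) (eps / 8 * (bad t j)%:R)%:E)%E); last first.
  apply: lee_sum => t _; rewrite /bad; set P := predict_prob _ _ _.
  have P1 : (P <= 1)%E.
    by apply: probability_le1; exact: measurable_play_history.
  have P0 : (0 <= P)%E by exact: measure_ge0.
  have : P \is a fin_num by rewrite ge0_fin_numE// (le_lt_trans P1)// ltry.
  move: P P0 P1 => [r| |]//; rewrite !lee_fin => r0 r1 _.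
  by case: (leP r (3 / 4)) => rP /=; nra.
rewrite sumEFin lee_fin -mulr_sumr -natr_sum.
have badjR : T%:R <= 3 * (\sum_(t < T) bad t j)%:R :> R.
  by rewrite -natrM ler_nat.
have -> : Num.sqrt c / 24 * Num.sqrt (T%:R * ln K%:R) = eps * T%:R / 24.
  have -> : eps * T%:R = Num.sqrt c * Num.sqrt (T%:R * ln K%:R).
    (* Writing T as sqrt (T^2) turns both sides into single square roots. *)
    rewrite -{1}(ger0_norm (ltW T0)) -sqrtr_sqr -!sqrtrM ?(ltW c0) ?(ltW x0)//.
    congr Num.sqrt.
    by rewrite expr2 mulrA divfK ?gt_eqF// -mulrA [ln _ * _]mulrC.
  by rewrite mulrAC.
nra.
Qed.
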